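(* Let $0<\theta<\frac\pi2$, let $\mu$ be a positive regular Borel measure supported in the sector $S(\theta)=\{z\in\mathbb C_+:|\arg z|<\theta\}$, and let $1<p\le q<\infty$. Then the following are equivalent: 1. The Laplace--Carleson embedding $\mathcal L:L^p(0,\infty)\to L^q(\mathbb C_+,\mu)$, $f\mapsto\mathcal Lf$, is well-defined and bounded. 2. There exists a constant $C>0$ such that $\mu(Q_I)\le C|I|^{q/p'}$ for all intervals $I\subset i\mathbb R$ which are symmetric about $0$. 3. There exists a constant $C>0$ such that $\|\mathcal Le^{-\cdot z}\|_{L^q(\mathbb C_+,\mu)}\le C\|e^{-\cdot z}\|_{L^p(0,\infty)}$ for all $z\in\mathbb R_+=(0,\infty)$. 4. There exists a constant $C>0$ such that $\|\mathcal Le^{-\cdot 2^n}\|_{L^q(\mathbb C_+,\mu)}\le C\|e^{-\cdot 2^n}\|_{L^p(0,\infty)}$ for all $n\in\mathbb Z$.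
   Context: $\mathbb C_+=\{\operatorname{Re}z>0\}$, $\mathcal Lf(s)=\int_0^\infty e^{-ts}f(t)\,dt$, and $p'$ is the conjugate exponent of $p$, $1/p+1/p'=1$. $e^{-\cdot z}$ denotes the function $t\mapsto e^{-tz}$ on $(0,\infty)$. For a bounded interval $I\subset i\mathbb R$ of length $|I|$, $Q_I=\{x+iy:iy\in I,\ 0<x<|I|\}$. *)

(* Defs.v *)
From mathcomp Require Import all_boot all_order all_algebra.
From mathcomp Require Import all_classical all_reals all_analysis.
From mathcomp Require Export complex.

Set Implicit Arguments.
Unset Strict Implicit.
Unset Printing Implicit Defensive.

Import Order.TTheory GRing.Theory Num.Theory.
Import numFieldNormedType.Exports.

Local Open Scope classical_set_scope.
Local Open Scope ring_scope.
Local Open Scope complex_scope.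

(* R[i]^o carries the topology of the modulus; borelC R is the type R[i] with
   its Borel sigma-algebra. *)
Notation borelC R := (g_sigma_algebraType (@open R[i]^o)).

Definition cexp (R : realType) (z : R[i]) : R[i] :=
  (expR (complex.Re z))%:C * (cos (complex.Im z) +i* sin (complex.Im z)).

(* Principal argument, with values in ]-pi, pi] for z != 0. *)
Definition Arg (R : realType) (z : R[i]) : R :=
  let a := acos (complex.Re z / ComplexField.Normc.normc z) in if 0 <= complex.Im z then a else - a.

Definition Cplus (R : realType) : set R[i] := [set z | 0 < complex.Re z].
Arguments Cplus : clear implicits.

Definition sector (R : realType) (theta : R) : set R[i] :=
  Cplus R `&` [set z | `|Arg z| < theta].

(* The interval I = i J of the imaginary axis is given by J. *)
Definition length (R : realType) (J : interval R) : R :=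
  fine (lebesgue_measure [set` J]).

Definition Qbox (R : realType) (J : interval R) : set R[i] :=
  [set z | complex.Im z \in J /\ 0 < complex.Re z < length J].

(* Regularity in the sense of Rudin: every Borel subset of the open set D is
   outer regular (by open sets) and inner regular (by compact sets), relative
   to D. Every Borel measure on D finite on compact sets has this property. *)
Definition regular_on (R : realType) (D : set R[i])
    (mu : {measure set (borelC R) -> \bar R}) : Prop :=
  forall A : set (borelC R), measurable A -> A `<=` D ->
    mu A = ereal_inf [set mu U | U in
             [set U : set (borelC R) |
               [/\ @open R[i]^o U, A `<=` U & U `<=` D]]] /\
    mu A = ereal_sup [set mu K | K in
             [set K : set (borelC R) | @compact R[i]^o K /\ K `<=` A]].

Section complex_valued.
Context d (T : measurableType d) (R : realType).
Variables (mu : {measure set T -> \bar R}) (D : set T).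
Implicit Types (f : T -> R[i]) (p : R).

Definition cintegrable f : Prop :=
  mu.-integrable D (EFin \o (fun x => complex.Re (f x))) /\
  mu.-integrable D (EFin \o (fun x => complex.Im (f x))).

Definition cintegral f : R[i] :=
  (\int[mu]_(x in D) complex.Re (f x)) +i* (\int[mu]_(x in D) complex.Im (f x)).

Definition cLnorm p f : \bar R :=
  'N[mu]_p%:E[(fun x => (ComplexField.Normc.normc (f x))%:E) \_ D]%E.

Definition in_cLp p f : Prop :=
  measurable_fun D (f : T -> borelC R) /\ (cLnorm p f < +oo)%E.
End complex_valued.

Section laplace.
Context (R : realType).
Implicit Types (f : R -> R[i]) (s z : R[i]) (p q : R).

Definition halfline : set R := `]0, +oo[%classic.

Definition expfun z : R -> R[i] := fun t => cexp (- (t%:C * z)).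

Definition laplace_defined f s : Prop :=
  cintegrable (@lebesgue_measure R) halfline (fun t => expfun s t * f t).

Definition laplace f s : R[i] :=
  cintegral (@lebesgue_measure R) halfline (fun t => expfun s t * f t).

Definition Lp_halfline p f : Prop :=
  in_cLp (@lebesgue_measure R) halfline p f.

Definition norm_halfline p f : \bar R :=
  cLnorm (@lebesgue_measure R) halfline p f.

Definition laplace_embedding_well_defined
    (mu : {measure set (borelC R) -> \bar R}) p q : Prop :=
  forall f, Lp_halfline p f ->
    (forall s, Cplus R s -> laplace_defined f s) /\
    in_cLp mu (Cplus R) q (laplace f).

Definition laplace_embedding_bounded
    (mu : {measure set (borelC R) -> \bar R}) p q : Prop :=
  exists2 C : R, 0 < C & forall f, Lp_halfline p f ->
    (cLnorm mu (Cplus R) q (laplace f) <= C%:E * norm_halfline p f)%E.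
End laplace.

(* Main.v *)
Require Import Defs.
From mathcomp Require Import all_boot all_order all_algebra.
From mathcomp Require Import all_classical all_reals all_analysis.
From mathcomp Require Import measurable_realfun.
From mathcomp Require Import ring lra.
Import Order.TTheory GRing.Theory Num.Theory.
Import numFieldNormedType.Exports.
Local Open Scope classical_set_scope.
Local Open Scope ring_scope.
Local Open Scope complex_scope.

Set Implicit Arguments.
Unset Strict Implicit.
Unset Printing Implicit Defensive.

(** On the sector the modulus of s is comparable to its real part x = Re s, and
    the Laplace transform satisfies |Lf(s)| <= 2 L|f|(x). The embedding is thus
    a statement about how mu distributes the values of Re s, and the four
    conditions all measure the same thing: the mass of the dyadic strips
    l <= Re s < 2 l of the sector is at most a multiple of l^(q/p').

    Exponentials give boxes. For z comparable to the length of a symmetric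
    interval I, the transform of e^(-tz) has modulus at least a constant over
    |I| on the whole box Q_I, because there cos (t Im s) e^(-t(Re s + z)) has an
    integral bounded below ([normc_laplace_expfun_ge]). Chebyshev's inequality
    then bounds mu(Q_I), and a dyadic z is always available
    ([box_of_dyadic_test]).

    Boxes give the embedding. Write phi(x) = x^a e^(-x) with a = (p-1)/2.
    Hölder's inequality with the weight (l t)^(1/(2p')) gives
      l^(p-1) (L|f|(l))^p <= c E(l),   E(l) = \int phi(l t) |f(t)|^p dt,
    ([integral_exp_average_le]), which rests on
    \int e^(-l t) t^(-1/2) dt <= 4 l^(-1/2). A strip lies in a symmetric box
    whose side is a multiple of l, so the integral of |Lf|^q over it is at most
    a multiple of l^(q/p') (l^(-(p-1)) E(l))^(q/p) = E(l)^(q/p)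
    ([integral_laplace_strip_le]). The sum of phi(2^i t) over any range of i is
    bounded independently of t, because phi is dominated by a difference of
    consecutive values of a bounded monotone function
    ([gamma_profile_le_telescope]). Hence the numbers E(2^i l) have sum, and
    therefore also maximum, at most c ||f||_p^p, and since q >= p the sum of
    their powers of order q/p is at most (c ||f||_p^p)^(q/p)
    ([integral_laplace_le]).

    The remaining implications restrict the embedding inequality to
    exponentials, and then to dyadic ones. *)

(** * Exponential integrals *)

(** A minorant of the cosine made of exponentials only: multiplied by an
    exponential it can be integrated in closed form. *)
Lemma ler_2B_expR_cos (R : realType) (u : R) : 0 <= u -> 2 - expR u <= cos u.
Proof.
move=> u0.
have [c _ h] : exists2 c : R, c \in `[0, u] & cos u - cos 0 = - sin c * (u - 0).
  apply: MVT_segment => //.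
  by apply: continuous_subspaceT => x; exact: continuous_cos.
have : 1 + u <= expR u by exact: expR_ge1Dx.
have : sin c <= 1 by apply: le_trans (ler_norm _) (sin_max _).
move: h; rewrite cos0 subr0; nra.
Qed.

Lemma ge0_integral_bigcup_nondecreasing_le d (T : measurableType d)
    (R : realType) (mu : {measure set T -> \bar R}) (F : (set T)^nat)
    (f : T -> \bar R) (B : \bar R) :
  nondecreasing_seq F -> (forall i, measurable (F i)) ->
  (forall i, measurable_fun (F i) f) -> (forall i x, F i x -> 0 <= f x)%E ->
  (forall i, \int[mu]_(x in F i) f x <= B)%E ->
  (\int[mu]_(x in \bigcup_i F i) f x <= B)%E.
Proof.
move=> ndF mF mf f0 fB.
have cF := ge0_nondecreasing_set_cvg_integral ndF mF mf f0.
rewrite -(cvg_lim _ (cF mu))//.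
apply: lime_le; first by apply/cvg_ex; eexists; exact: cF.
by apply: nearW => i; exact: fB.
Qed.

(** The form of [gt0_ler_poweR] in which membership in [0, +oo] is only
    asked of the smaller side. *)
Lemma ge0_lee_poweR (R : realType) (r : R) (x y : \bar R) : 0 <= r ->
  (0 <= x -> x <= y -> x `^ r <= y `^ r)%E.
Proof.
move=> r0 x0 xy; apply: gt0_ler_poweR => //; rewrite in_itv/= leey ?x0//.
by rewrite (le_trans x0).
Qed.

Lemma measurable_expRN (R : realType) (l : R) (D : set R) :
  measurable_fun D (fun t => expR (- (l * t))).
Proof.
apply: measurable_funTS; apply: measurableT_comp => //.
by apply: measurable_funN; exact: mulrl_measurable.
Qed.

Lemma integral_expRN (R : realType) (l : R) : 0 < l ->
  (\int[@lebesgue_measure R]_(t in @halfline R) (expR (- (l * t)))%:E =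
   (l^-1)%:E)%E.
Proof.
move=> l0.
have dF (x : R) : is_derive x 1 (fun t => - l^-1 * expR (- (l * t)))
                    (expR (- (l * x))).
  apply: is_derive_eq => /=; rewrite /GRing.scale/=.
  field; exact: lt0r_neq0.
rewrite /halfline integral_itv_obnd_cbnd; last first.
  by apply/measurable_EFinP; exact: measurable_expRN.
rewrite (@ge0_continuous_FTC2y _ _ (fun t => - l^-1 * expR (- (l * t))) _ 0)//=.
- by rewrite mulr0 oppr0 expR0 mulr1 -EFinB sub0r opprK.
- apply: continuous_subspaceT => x.
  apply: (@continuous_comp _ _ _ (fun x => - (l * x)) expR);
    last exact: continuous_expR.
  by apply: cvgN; apply: cvgMr; exact: cvg_id.
- rewrite -(mulr0 (- l^-1)); apply: cvgMr.
  apply: (@cvg_comp _ _ _ (fun x => l * x) (fun x => expR (- x))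
    _ (pinfty_nbhs R)); last exact: cvgr_expR.
  by apply: gt0_cvgMry => //; exact: cvg_id.
- apply: cvg_at_right_filter; have [d0 _] := dF 0.
  by have/derivable1_diffP/differentiable_continuous := d0.
- by move=> x _; rewrite derive1E derive_val.
Qed.

Section square_root_weight.
Context {R : realType}.

Lemma sqr_1Dsqrt_le_expR (x : R) : 0 <= x -> (1 + Num.sqrt x) ^+ 2 <= 2 * expR x.
Proof.
move=> x0; have := expR_ge1Dx x; have := sqr_sqrtr x0.
set s := Num.sqrt x => sx ex; have : 0 <= (1 - s) ^+ 2 by exact: sqr_ge0.
by move: sx; rewrite !expr2; nra.
Qed.

(** Since (1 + sqrt x)^2 <= 2 e^x, the integrand is dominated by a multiple
    of the derivative of the bounded function -1 / (1 + sqrt (l t)). The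
    fundamental theorem applies on [1/n, +oo[ only, the integrand being
    unbounded at 0, hence the exhaustion. *)
Lemma integral_expRN_powRNhalf_le (l : R) : 0 < l ->
  (\int[@lebesgue_measure R]_(t in @halfline R)
     (expR (- (l * t)) * t `^ (- 2^-1))%:E <= (4 * l `^ (- 2^-1))%:E)%E.
Proof.
move=> l0; rewrite powRN (powR12_sqrt (ltW l0)).
set s := Num.sqrt l; have s0 : 0 < s by rewrite sqrtr_gt0.
pose G (t : R) := - (4 / s) * (1 + s * Num.sqrt t)^-1.
pose g (t : R) := 2 * ((1 + s * Num.sqrt t) ^+ 2)^-1 * (Num.sqrt t)^-1.
have den0 (t : R) : 0 < 1 + s * Num.sqrt t.
  by rewrite ltr_wpDr// mulr_ge0 ?sqrtr_ge0 ?ltW.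
have dG (x : R) : 0 < x -> is_derive x 1 G (g x).
  move=> x0; rewrite /G /g.
  have sx0 : 0 < Num.sqrt x by rewrite sqrtr_gt0.
  have ds := is_derive1_sqrt x0.
  have dV : is_derive x 1 (fun t => 1 + s * Num.sqrt t)
      (s * (2 * Num.sqrt x)^-1).
    have := is_deriveD (is_derive_cst (1 : R) x 1) (is_deriveZ s ds).
    by rewrite /GRing.scale/= add0r.
  have dI := @is_deriveV _ (fun t => 1 + s * Num.sqrt t) _ _ _
    (lt0r_neq0 (den0 x)) dV.
  have := is_deriveZ (- (4 / s)) dI => /is_derive_eq; apply; rewrite /GRing.scale/=.
  field; rewrite !lt0r_neq0//=.
have gcont (x : R) : 0 < x -> {for x, continuous g}.
  move=> x0; have cs := @sqrt_continuous R x.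
  apply: cvgM; last by apply: cvgV => //; rewrite lt0r_neq0// sqrtr_gt0.
  apply: cvgMr; apply: cvgV; first by rewrite lt0r_neq0// exprn_gt0.
  have : 1 + s * Num.sqrt t @[t --> x] --> 1 + s * Num.sqrt x.
    by apply: cvgD; [exact: cvg_cst|apply: cvgMr].
  by move=> /[dup] c1 c2; exact: cvgM c1 c2.
pose F (n : nat) : set R := `[n.+1%:R^-1, +oo[%classic.
have F0 n x : F n x -> 0 < x.
  by rewrite /F /= in_itv/= andbT; apply: lt_le_trans; rewrite invr_gt0.
have -> : @halfline R = \bigcup_n F n.
  apply/seteqP; split=> t; rewrite /halfline /= in_itv/= andbT.
    move=> /ltr_add_invr[n]; rewrite add0r => nt; exists n => //.
    by rewrite /F /= in_itv/= andbT ltW.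
  by move=> [n _]; exact: F0.
have gF i : {within F i, continuous g}.
  apply: continuous_in_subspaceT => x /set_mem/F0; exact: gcont.
have mh i : measurable_fun (F i)
    (fun t => expR (- (l * t)) * t `^ (- 2^-1)).
  apply: measurable_funM; first exact: measurable_expRN.
  exact: (measurable_funTS (measurable_powR _)).
apply: ge0_integral_bigcup_nondecreasing_le.
- move=> m n mn; rewrite subsetEset; apply: subset_itvr; rewrite bnd_simp.
  by rewrite lef_pV2 ?posrE// ler_nat.
- by move=> i; exact: measurable_itv.
- move=> i; apply/measurable_EFinP; exact: mh.
- by move=> i x _; rewrite lee_fin mulr_ge0 ?expR_ge0 ?powR_ge0.
move=> i; set a := i.+1%:R^-1 : R.
have a0 : 0 < a by rewrite invr_gt0.
apply: (@le_trans _ _ (\int[@lebesgue_measure R]_(t in F i) (g t)%:E)%E).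
  apply: ge0_le_integral => //.
  - exact: measurable_itv.
  - by move=> x _; rewrite lee_fin mulr_ge0 ?expR_ge0 ?powR_ge0.
  - apply/measurable_EFinP; exact: mh.
  - apply/measurable_EFinP; apply: subspace_continuous_measurable_fun => //.
    exact: measurable_itv.
  move=> x /F0 x0; rewrite lee_fin powRN (powR12_sqrt (ltW x0)) /g.
  rewrite ler_wpM2r ?invr_ge0 ?sqrtr_ge0// expRN.
  rewrite -[leLHS]mul1r ler_pdivrMr ?expR_gt0//.
  rewrite mulrAC ler_pdivlMr ?exprn_gt0// mul1r.
  rewrite /s -(sqrtrM _ (ltW l0)); apply: sqr_1Dsqrt_le_expR.
  by rewrite ltW ?mulr_gt0.
rewrite /F (@ge0_continuous_FTC2y R g G a 0).
- rewrite -EFinB lee_fin sub0r /G mulNr opprK.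
  rewrite ler_piMr ?divr_ge0 ?(ltW s0)// invf_le1//.
  by rewrite lerDl mulr_ge0 ?sqrtr_ge0 ?(ltW s0).
- by move=> x _; rewrite /g !mulr_ge0 ?invr_ge0 ?sqrtr_ge0 ?sqr_ge0.
- exact: (gF i).
- rewrite -(mulr0 (- (4 / s))); apply: cvgMr.
  apply/gtr0_cvgV0; first exact: nearW.
  apply/cvgryPge => A.
  apply: filterS (nbhs_pinfty_ge (num_real ((A / s) ^+ 2))) => t tA.
  rewrite (@le_trans _ _ (s * Num.sqrt t))//; last by rewrite lerDr.
  rewrite mulrC -ler_pdivrMr// (le_trans (ler_norm _))//.
  rewrite -sqrtr_sqr ler_wsqrtr//.
- move=> x ax; have x0 := lt_trans a0 ax.
  by have [] := dG x x0.
- apply: cvg_at_right_filter; have [d0 _] := dG a a0.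
  by have/derivable1_diffP/differentiable_continuous := d0.
- move=> x; rewrite in_itv/= andbT => ax; have x0 := lt_trans a0 ax.
  by rewrite derive1E; have [_ ->] := dG x x0.
Qed.

End square_root_weight.

(** * Dyadic sums of the gamma profile *)

Section gamma_profile.
Context {R : realType}.
Variable al : R.
Hypothesis al0 : 0 < al.

(** Up to normalisation, the density of the gamma distribution of shape [al
    + 1]. *)
Definition gamma_profile (x : R) : R := x `^ al * expR (- x).

Lemma gamma_profile_ge0 x : 0 <= gamma_profile x.
Proof. by rewrite mulr_ge0 ?powR_ge0 ?expR_ge0. Qed.

(** Apply y <= e^y to y = x / (2 al) and raise to the power [al]. *)
Lemma powR_le_expR_half x : 0 < x -> x `^ al <= (2 * al) `^ al * expR (x / 2).
Proof.
move=> x0; have a20 : 0 < 2 * al by rewrite mulr_gt0.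
have -> : x = (2 * al) * (x / (2 * al)) by field; exact: lt0r_neq0.
rewrite powRM ?mulr_ge0 ?invr_ge0 ?(ltW x0) ?(ltW al0) ?(ltW a20)//.
rewrite ler_wpM2l ?powR_ge0//.
set y := x / (2 * al); have -> : 2 * al * y / 2 = y * al by field.
rewrite expRM ge0_ler_powR ?(ltW al0)// ?nnegrE ?expR_ge0//.
  by rewrite divr_ge0 ?(ltW x0) ?(ltW a20).
by rewrite (le_trans _ (expR_ge1Dx y))// lerDr.
Qed.

(** With X = x^al and A = 2^al, the difference on the right is (A - 1) X /
    ((1 + X)(1 + A X)), and (1 + X)^2 is at most a multiple of e^x. The
    right-hand sides at x, 2x, 4x, ... telescope. *)
Lemma gamma_profile_le_telescope : exists2 c : R, 0 < c &
  forall x, 0 < x -> gamma_profile x <=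
    c * ((1 + x `^ al)^-1 - (1 + (2 * x) `^ al)^-1).
Proof.
pose A : R := 2 `^ al; pose B : R := (2 * al) `^ al.
have A1 : 1 < A.
  have := gt0_ltr_powR al0 (x := 1) (y := 2); rewrite powR1; apply;
    by rewrite ?nnegrE// ltr1n.
have B0 : 0 <= B by exact: powR_ge0.
(* B e^(x/2) bounds x^al, so that (1 + X)^2 <= (1 + B)^2 e^x. *)
exists (A * (1 + B) ^+ 2 / (A - 1)).
  by rewrite divr_gt0 ?subr_gt0// mulr_gt0 ?exprn_gt0 ?(lt_trans _ A1)//;
    rewrite ltr_wpDr.
move=> x x0; rewrite /gamma_profile powRM ?(ltW x0)// -/A.
have := powR_le_expR_half x0; rewrite -/B.
have : 1 <= expR (x / 2) by rewrite -expR0 ler_expR divr_ge0// ltW.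
have -> : expR (- x) = (expR (x / 2) ^+ 2)^-1.
  by rewrite -expRM_natl expRN; congr (expR _)^-1; field.
set E := expR _; set X := x `^ al => E1 XE.
have X0 : 0 < X by rewrite powR_gt0.
have -> : A * (1 + B) ^+ 2 / (A - 1) * ((1 + X)^-1 - (1 + A * X)^-1) =
    X * (A * (1 + B) ^+ 2 / ((1 + X) * (1 + A * X))).
  field; apply/and3P; split; rewrite lt0r_neq0 ?subr_gt0//; nra.
rewrite ler_wpM2l ?(ltW X0)//.
rewrite ler_pdivlMr ?mulr_gt0//; try nra.
rewrite mulrC ler_pdivrMr ?exprn_gt0//; last exact: lt_le_trans E1.
have h1 : (1 + X) <= (1 + B) * E by nra.
have h2 : (1 + A * X) <= A * (1 + X) by nra.
apply: (@le_trans _ _ (A * (1 + X) ^+ 2)).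
  by rewrite expr2 mulrCA ler_wpM2l//; nra.
rewrite -mulrA ler_wpM2l//; first by nra.
by rewrite -exprMn ler_pXn2r ?nnegrE//; nra.
Qed.

(** Starting the sum at an arbitrary point [x] covers every window of
    integer exponents, so no sum over negative indices is needed. *)
Lemma sum_gamma_profile_dyadic_le : exists2 c : R, 0 < c &
  forall n x, 0 < x -> \sum_(i < n) gamma_profile (2 ^+ i * x) <= c.
Proof.
have [c c0 hc] := gamma_profile_le_telescope; exists c => // n x x0.
pose f (i : nat) := - (1 + (2 ^+ i * x) `^ al)^-1.
apply: (@le_trans _ _ (\sum_(i < n) c * (f i.+1 - f i))).
  apply: ler_sum => i _; rewrite /f opprK addrC exprS -mulrA.
  by apply: hc; rewrite mulr_gt0 ?exprn_gt0.
rewrite -mulr_sumr -(big_mkord xpredT (fun i => f i.+1 - f i)) telescope_sumr//.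
rewrite -[leRHS]mulr1 ler_wpM2l ?(ltW c0)// /f opprK.
rewrite addrC (@le_trans _ _ (1 + (2 ^+ 0 * x) `^ al)^-1)//.
  by rewrite gerDl oppr_le0 invr_ge0 addr_ge0 ?powR_ge0.
by rewrite invf_le1 ?lerDl ?powR_ge0// ltr_wpDr ?powR_ge0.
Qed.

Lemma measurable_gamma_profile (D : set R) : measurable_fun D gamma_profile.
Proof.
apply: measurable_funTS; apply: measurable_funM; first exact: measurable_powR.
by apply: measurableT_comp => //; exact: measurable_funN.
Qed.

End gamma_profile.

(** * The Borel structure of the complex plane and the sector *)

Section borel_complex.
Context {R : realType}.
Implicit Types (z w : R[i]).
Local Notation normc := ComplexField.Normc.normc.

Lemma normcE z : normc z = Num.sqrt (complex.Re z ^+ 2 + complex.Im z ^+ 2).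
Proof. by case: z. Qed.

Lemma norm_complexE z : `|z| = (normc z)%:C.
Proof. by case: z. Qed.

Lemma normc_ge0 z : 0 <= normc z.
Proof. by rewrite normcE sqrtr_ge0. Qed.

Lemma ler_norm_Re_normc z : `|complex.Re z| <= normc z.
Proof. by rewrite normcE -sqrtr_sqr ler_wsqrtr// lerDl sqr_ge0. Qed.

Lemma ler_norm_Im_normc z : `|complex.Im z| <= normc z.
Proof. by rewrite normcE -sqrtr_sqr ler_wsqrtr// lerDr sqr_ge0. Qed.

Lemma ler_normc_ReDIm z : normc z <= `|complex.Re z| + `|complex.Im z|.
Proof.
rewrite normcE -[leRHS]ger0_norm ?addr_ge0// -sqrtr_sqr ler_wsqrtr//.
rewrite sqrrD !real_normK ?num_real// mulr2n.
have : 0 <= `|complex.Re z| * `|complex.Im z| by rewrite mulr_ge0.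
lra.
Qed.

(** Reduces the topology of the complex plane, whose balls have complex
    radii, to real radii. *)
Lemma open_complexP (U : set R[i]) : @open R[i]^o U <->
  forall z, U z -> exists2 e : R, 0 < e & forall w, normc (z - w) < e -> U w.
Proof.
split=> [oU z Uz|h].
  have : nbhs (z : R[i]^o) U by apply: open_nbhs_nbhs; split.
  move=> /nbhs_ballP[e /= e0 eU].
  move: e0; rewrite ltcE/= => /andP[/eqP ime re0].
  exists (complex.Re e) => // w zw; apply: eU.
  rewrite /ball/= /ball_/= norm_complexE.
  by rewrite ltcE/= ime eqxx.
rewrite openE => z Uz /=.
have [e e0 eU] := h z Uz.
apply/nbhs_ballP; exists e%:C => /=; first by rewrite ltcR.
move=> w; rewrite /ball/= /ball_/= norm_complexE ltcR; exact: eU.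
Qed.

Lemma measurable_Re : measurable_fun setT (@complex.Re R : borelC R -> R).
Proof.
apply: (measurability _ (RGenOInfty.measurableE R)) => _ [_ [a ->] <-].
rewrite setTI; apply: sub_sigma_algebra; apply/open_complexP => z /=.
rewrite in_itv/= andbT => az; exists (complex.Re z - a); first by rewrite subr_gt0.
move=> w zw; rewrite in_itv/= andbT.
have := le_lt_trans (ler_norm_Re_normc (z - w)) zw.
move=> /(le_lt_trans (ler_norm _)).
by case: z w {zw az} => [x y] [x' y'] /=; lra.
Qed.

Lemma measurable_Im : measurable_fun setT (@complex.Im R : borelC R -> R).
Proof.
apply: (measurability _ (RGenOInfty.measurableE R)) => _ [_ [a ->] <-].
rewrite setTI; apply: sub_sigma_algebra; apply/open_complexP => z /=.
rewrite in_itv/= andbT => az; exists (complex.Im z - a); first by rewrite subr_gt0.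
move=> w zw; rewrite in_itv/= andbT.
have := le_lt_trans (ler_norm_Im_normc (z - w)) zw.
move=> /(le_lt_trans (ler_norm _)).
by case: z w {zw az} => [x y] [x' y'] /=; lra.
Qed.

Lemma measurable_normc :
  measurable_fun setT (@ComplexField.Normc.normc R : borelC R -> R).
Proof.
rewrite (_ : @ComplexField.Normc.normc R = Num.sqrt \o
  (fun z => complex.Re z ^+ 2 + complex.Im z ^+ 2)); last first.
  by apply/funext => z; rewrite normcE.
apply: measurableT_comp.
  by apply: continuous_measurable_fun; exact: sqrt_continuous.
by apply: measurable_funD; apply: measurable_funX;
  [exact: measurable_Re|exact: measurable_Im].
Qed.

(** Second countability: the squares with rational centre and size contained
    in an open set cover it. *)
Lemma open_complex_bigcup (U : set R[i]) : @open R[i]^o U ->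
  U = \bigcup_(c in [set c : rat * rat * rat | forall w,
         `|complex.Re w - ratr c.1.1| < ratr c.2 ->
         `|complex.Im w - ratr c.1.2| < ratr c.2 -> U w])
      [set w | `|complex.Re w - ratr c.1.1| < ratr c.2 /\
               `|complex.Im w - ratr c.1.2| < ratr c.2].
Proof.
move=> /open_complexP oU; apply/seteqP; split=> [z Uz|z [c /= cU [c1 c2]]];
  last exact: cU.
have [e e0 eU] := oU z Uz.
(* Two points of a square of size r < e / 4 are at distance less than 4 r. *)
have e4 : 0 < e / 4 by rewrite divr_gt0.
have [r] := rat_in_itvoo e4; rewrite in_itv/= => /andP[r0 re].
have [a] := @rat_in_itvoo _ (complex.Re z - ratr r) (complex.Re z + ratr r)
  ltac:(lra).
have [b] := @rat_in_itvoo _ (complex.Im z - ratr r) (complex.Im z + ratr r)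
  ltac:(lra).
rewrite !in_itv/= => /andP[b1 b2] /andP[a1 a2].
exists (a, b, r) => /=; last by rewrite !ltr_norml; lra.
move=> w; rewrite !ltr_norml => /andP[h1 h2] /andP[h3 h4]; apply: eU.
apply: (le_lt_trans (ler_normc_ReDIm _)).
have : `|complex.Re (z - w)| < e / 2.
  by case: z w {Uz} a1 a2 b1 b2 h1 h2 h3 h4 => [x y] [x' y'] /= *;
    rewrite ltr_norml; lra.
have : `|complex.Im (z - w)| < e / 2; last by lra.
by case: z w {Uz} a1 a2 b1 b2 h1 h2 h3 h4 => [x y] [x' y'] /= *;
    rewrite ltr_norml; lra.
Qed.

Lemma measurable_funC d (T : measurableType d) (D : set T) (f : T -> borelC R) :
  measurable_fun D (fun x => complex.Re (f x)) ->
  measurable_fun D (fun x => complex.Im (f x)) ->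
  measurable_fun D f.
Proof.
move=> mre mim mD; move: (mD).
apply: (@measurability _ _ T (borelC R) D f (@open R[i]^o) erefl) => _ [U oU <-].
rewrite (open_complex_bigcup oU) preimage_bigcup setI_bigcupr.
rewrite bigcup_mkcond; apply: countable_bigcupT_measurable => // c.
case: ifPn => _ //.
have mfr (g : T -> R) (a r : R) : measurable_fun D g ->
    measurable (D `&` [set x | `|g x - a| < r]).
  move=> mg; have : measurable_fun D (fun x => `|g x - a|).
    by apply: measurableT_comp => //; apply: measurable_funB.
  move=> /(_ mD `]-oo, r[%classic (measurable_itv _)).
  by congr measurable; apply/seteqP; split=> x /=; rewrite in_itv.
rewrite (_ : _ `&` _ =
  (D `&` [set x | `|complex.Re (f x) - ratr c.1.1| < ratr c.2]) `&`
  (D `&` [set x | `|complex.Im (f x) - ratr c.1.2| < ratr c.2])).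
  by apply: measurableI; exact: mfr.
by apply/seteqP; split=> x /=; tauto.
Qed.

Lemma measurable_Re_comp d (T : measurableType d) (D : set T)
  (f : T -> borelC R) : measurable_fun D f ->
  measurable_fun D (fun x => complex.Re (f x)).
Proof. exact: (measurableT_comp measurable_Re). Qed.

Lemma measurable_Im_comp d (T : measurableType d) (D : set T)
  (f : T -> borelC R) : measurable_fun D f ->
  measurable_fun D (fun x => complex.Im (f x)).
Proof. exact: (measurableT_comp measurable_Im). Qed.

Lemma measurable_Re_itv (J : interval R) :
  measurable ([set z | complex.Re z \in J] : set (borelC R)).
Proof.
rewrite -[X in measurable X]setTI.
exact: (measurable_Re measurableT (measurable_itv J)).
Qed.

Lemma measurable_Im_itv (J : interval R) :
  measurable ([set z | complex.Im z \in J] : set (borelC R)).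
Proof.
rewrite -[X in measurable X]setTI.
exact: (measurable_Im measurableT (measurable_itv J)).
Qed.

Lemma measurable_Cplus : measurable (Cplus R : set (borelC R)).
Proof.
rewrite (_ : Cplus R = [set z | complex.Re z \in `]0, +oo[]).
  exact: measurable_Re_itv.
by apply/seteqP; split=> z; rewrite /Cplus/= in_itv/= andbT.
Qed.

Lemma measurable_Qbox (J : interval R) :
  measurable (Qbox J : set (borelC R)).
Proof.
rewrite (_ : Qbox J = [set z | complex.Im z \in J] `&`
    [set z | complex.Re z \in `]0, length J[]).
  by apply: measurableI; [exact: measurable_Im_itv|exact: measurable_Re_itv].
by apply/seteqP; split=> z; rewrite /Qbox/= in_itv.
Qed.

(** The cosine decreases on [0, pi], so the condition on the argument
    becomes a comparison of measurable functions. *)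
Lemma sectorE (theta : R) : 0 < theta < pi / 2 -> sector theta =
  Cplus R `&` [set z | cos theta * normc z < complex.Re z].
Proof.
move=> /andP[t0 tpi].
have tpi' : theta \in `[0, pi].
  rewrite in_itv/= (ltW t0)/= ltW// (lt_le_trans tpi)//.
  by rewrite ler_pdivrMr// ler_peMr ?pi_ge0// ler1n.
rewrite /sector; apply/seteqP.
suff h z : 0 < complex.Re z ->
    (`|Arg z| < theta) = (cos theta * normc z < complex.Re z).
  by split=> z [z0 /=]; rewrite /Cplus/= in z0 *; rewrite h.
move=> z0.
have n0 : 0 < normc z.
  by rewrite (lt_le_trans z0)// (le_trans (ler_norm _))// ler_norm_Re_normc.
set r := complex.Re z / normc z.
have r0 : 0 < r by rewrite divr_gt0.
have r1 : r <= 1.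
  by rewrite ler_pdivrMr// mul1r (le_trans (ler_norm _))// ler_norm_Re_normc.
have r11 : -1 <= r <= 1 by rewrite r1 andbT (le_trans _ (ltW r0)).
have -> : `|Arg z| = acos r.
  rewrite -[RHS](ger0_norm (acos_ge0 r11)).
  by rewrite /Arg -/r; case: ifP => _; rewrite ?normrN.
have ar : acos r \in `[0, pi] by rewrite in_itv/= acos_ge0// acos_lepi.
by rewrite -(ltr_cos ar tpi') acosK ?in_itv//= ltr_pdivlMr.
Qed.

Lemma measurable_sector (theta : R) : 0 < theta < pi / 2 ->
  measurable (sector theta : set (borelC R)).
Proof.
move=> t0; rewrite sectorE//; apply: measurableI; first exact: measurable_Cplus.
rewrite (_ : mkset _ =
  setT `&` (fun z : borelC R => complex.Re z - cos theta * normc z) @^-1`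
    `]0, +oo[%classic).
  have : measurable_fun setT
      (fun z : borelC R => complex.Re z - cos theta * normc z).
    apply: measurable_funB; first exact: measurable_Re.
    by apply: measurable_funM => //; exact: measurable_normc.
  by apply=> //; exact: measurable_itv.
by rewrite setTI; apply/seteqP; split=> z /=; rewrite in_itv/= andbT subr_gt0.
Qed.

End borel_complex.

(** * Measurability of the Laplace transform *)

(** Tonelli's theorem, applied to the positive and the negative part, gives
    measurability in the parameter whether or not the integrals are finite. *)
Lemma measurable_Rintegral_param d (T : measurableType d) (R : realType)
    (G : T * R -> R) :
  measurable_fun setT G ->
  measurable_fun setT (fun s => \int[@lebesgue_measure R]_t G (s, t)).
Proof.
move=> mG; apply: measurableT_comp; first exact: fine_measurable.
have mGE : measurable_fun setT (EFin \o G) by exact/measurable_EFinP.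
rewrite [X in measurable_fun _ X](_ : _ = (fun s =>
  \int[@lebesgue_measure R]_t ((EFin \o G)^\+ (s, t)) -
  \int[@lebesgue_measure R]_t ((EFin \o G)^\- (s, t)))%E); last first.
  by apply/funext => s; rewrite [LHS]integralE;
    congr (_ - _)%E; apply: eq_integral => t _; rewrite ?funeposE ?funenegE.
apply: emeasurable_funB.
- apply: (measurable_fun_fubini_tonelli_F (m2 := @lebesgue_measure R)
    ((EFin \o G)^\+)%E) => //.
  exact: measurable_funepos.
- apply: (measurable_fun_fubini_tonelli_F (m2 := @lebesgue_measure R)
    ((EFin \o G)^\-)%E) => //.
  exact: measurable_funeneg.
Qed.

Section laplace_measurability.
Context {R : realType}.
Implicit Types (f : R -> R[i]) (s w : R[i]) (t : R).
Local Notation normc := ComplexField.Normc.normc.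

Lemma expfunE s t : expfun s t = (expR (- (complex.Re s * t)))%:C *
  (cos (complex.Im s * t) -i* sin (complex.Im s * t)).
Proof.
case: s => x y; rewrite /expfun /cexp /=.
rewrite !mul0r subr0 addr0 (mulrC t x) (mulrC t y).
by rewrite cosN sinN.
Qed.

Lemma Re_expfun_mul s t w : complex.Re (expfun s t * w) =
  expR (- (complex.Re s * t)) * (cos (complex.Im s * t) * complex.Re w +
                                 sin (complex.Im s * t) * complex.Im w).
Proof. by rewrite expfunE; case: w => a b /=; ring. Qed.

Lemma Im_expfun_mul s t w : complex.Im (expfun s t * w) =
  expR (- (complex.Re s * t)) * (cos (complex.Im s * t) * complex.Im w -
                                 sin (complex.Im s * t) * complex.Re w).
Proof. by rewrite expfunE; case: w => a b /=; ring. Qed.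

Lemma normc_expfun s t : normc (expfun s t) = expR (- (complex.Re s * t)).
Proof.
rewrite expfunE ComplexField.Normc.normcM !normcE /= expr0n addr0 sqrtr_sqr.
by rewrite sqrrN cos2Dsin2 sqrtr1 mulr1 ger0_norm ?expR_ge0.
Qed.

Lemma measurable_halfline : measurable (@halfline R).
Proof. exact: measurable_itv. Qed.

Lemma measurable_cos : measurable_fun setT (@cos R).
Proof. by apply: continuous_measurable_fun; exact: continuous_cos. Qed.

Lemma measurable_sin : measurable_fun setT (@sin R).
Proof. by apply: continuous_measurable_fun; exact: continuous_sin. Qed.

Lemma measurable_expfun_mul s f (D : set R) :
  measurable_fun D (f : R -> borelC R) ->
  measurable_fun D (fun t => expfun s t * f t : borelC R).
Proof.
move=> mf.
have mcos : measurable_fun D (fun t => cos (complex.Im s * t)).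
  apply: measurable_funTS.
  exact: (measurableT_comp measurable_cos (@mulrl_measurable _ _ _)).
have msin : measurable_fun D (fun t => sin (complex.Im s * t)).
  apply: measurable_funTS.
  exact: (measurableT_comp measurable_sin (@mulrl_measurable _ _ _)).
have mre := measurable_Re_comp mf; have mim := measurable_Im_comp mf.
apply: measurable_funC.
- under eq_fun do rewrite Re_expfun_mul.
  apply: measurable_funM; first exact: measurable_expRN.
  by apply: measurable_funD; exact: measurable_funM.
- under eq_fun do rewrite Im_expfun_mul.
  apply: measurable_funM; first exact: measurable_expRN.
  by apply: measurable_funB; exact: measurable_funM.
Qed.

Lemma measurable_expfun s (D : set R) :
  measurable_fun D (expfun s : R -> borelC R).
Proof.
have := @measurable_expfun_mul s (cst 1) D (measurable_cst _).
by under eq_fun do rewrite mulr1.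
Qed.

(** Real and imaginary part of the Laplace integrand are both of this form,
    with (a, b) = (Re f, Im f) and (a, b) = (Im f, - Re f). *)
Lemma measurable_fun_laplace_kernel (a b : R -> R) :
  measurable_fun setT a -> measurable_fun setT b ->
  measurable_fun setT (fun st : borelC R * R =>
    expR (- (complex.Re st.1 * st.2)) *
    (cos (complex.Im st.1 * st.2) * a st.2 +
     sin (complex.Im st.1 * st.2) * b st.2)).
Proof.
move=> ma mb.
have mre : measurable_fun setT (fun st : borelC R * R =>
    complex.Re st.1 * st.2).
  apply: measurable_funM; last exact: measurable_snd.
  exact: (measurableT_comp measurable_Re measurable_fst).
have mim : measurable_fun setT (fun st : borelC R * R =>
    complex.Im st.1 * st.2).
  apply: measurable_funM; last exact: measurable_snd.
  exact: (measurableT_comp measurable_Im measurable_fst).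
apply: measurable_funM.
  by apply: measurableT_comp => //; exact: measurable_funN.
apply: measurable_funD; apply: measurable_funM.
- apply: measurableT_comp; last exact: mim.
  exact: measurable_cos.
- exact: measurableT_comp.
- apply: measurableT_comp; last exact: mim.
  exact: measurable_sin.
- exact: measurableT_comp.
Qed.

Lemma measurable_laplace f (D : set (borelC R)) :
  measurable_fun (@halfline R) (f : R -> borelC R) ->
  measurable_fun D (laplace f : borelC R -> borelC R).
Proof.
move=> mf; apply: measurable_funTS.
pose a := (fun t => complex.Re (f t)) \_ (@halfline R).
pose b := (fun t => complex.Im (f t)) \_ (@halfline R).
have ma : measurable_fun setT a.
  apply/(measurable_restrictT _ measurable_halfline).
  exact: measurable_Re_comp.
have mb : measurable_fun setT b.
  apply/(measurable_restrictT _ measurable_halfline).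
  exact: measurable_Im_comp.
apply: measurable_funC.
- have := measurable_Rintegral_param (measurable_fun_laplace_kernel ma mb).
  congr measurable_fun; apply/funext => s /=.
  rewrite [RHS]Rintegral_mkcond; congr Rintegral; apply/funext => t.
  rewrite /a /b !patchE; case: ifP => _; rewrite ?Re_expfun_mul//.
  by rewrite !mulr0 addr0 mulr0.
- have mb' : measurable_fun setT (\- a) by exact: measurable_funN.
  have := measurable_Rintegral_param (measurable_fun_laplace_kernel mb mb').
  congr measurable_fun; apply/funext => s /=.
  rewrite [RHS]Rintegral_mkcond; congr Rintegral; apply/funext => t.
  rewrite /a /b /= !patchE; case: ifP => _; first by rewrite Im_expfun_mul mulrN.
  by rewrite oppr0 !mulr0 addr0 mulr0.
Qed.

End laplace_measurability.

(** * Hölder's inequality with a power weight *)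

Section Lnorm_restrict.
Context d (T : measurableType d) (R : realType).
Variables (mu : {measure set T -> \bar R}) (D : set T).
Implicit Types (u v : T -> R) (p : R).

Lemma Lnorm_restrict_EFin u p : p != 0 -> (forall x, D x -> 0 <= u x) ->
  ('N[mu]_p%:E[(EFin \o u) \_ D] =
   (\int[mu]_(x in D) (u x `^ p)%:E) `^ p^-1)%E.
Proof.
move=> p0 u0; rewrite unlock; congr (_ `^ _)%E.
rewrite [RHS]integral_mkcond; apply: eq_integral => x _.
rewrite !patchE; case: ifPn => [/set_mem Dx|_] /=; last by rewrite normr0 powR0.
by rewrite ger0_norm// u0.
Qed.

(** The exponent on the first factor is p / p' = p - 1. *)
Lemma hoelder_powR u v p p' : 1 < p -> p^-1 + p'^-1 = 1 -> measurable D ->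
  measurable_fun D u -> measurable_fun D v ->
  (forall x, D x -> 0 <= u x) -> (forall x, D x -> 0 <= v x) ->
  ((\int[mu]_(x in D) (u x * v x)%:E) `^ p <=
   (\int[mu]_(x in D) (u x `^ p')%:E) `^ (p - 1) *
   \int[mu]_(x in D) (v x `^ p)%:E)%E.
Proof.
move=> p1 pp' mD mu_ mv u0 v0.
have p0 : 0 < p by rewrite (lt_trans _ p1).
have p'E : p'^-1 = 1 - p^-1 by rewrite -pp' addrC addKr.
have p'0 : 0 < p' by rewrite -invr_gt0 p'E subr_gt0 invf_lt1.
have mu' : measurable_fun setT (u \_ D) by apply/(measurable_restrictT _ mD).
have mv' : measurable_fun setT (v \_ D) by apply/(measurable_restrictT _ mD).
have p'p : p'^-1 + p^-1 = 1 by rewrite addrC.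
have := hoelder mu mu' mv' p'0 p0 p'p.
rewrite -!restrict_EFin !Lnorm_restrict_EFin ?gt_eqF// Lnorm1.
have -> : (\int[mu]_x `|(EFin \o (u \_ D \* v \_ D)%R) x| =
    \int[mu]_(x in D) (u x * v x)%:E)%E.
  rewrite [RHS]integral_mkcond; apply: eq_integral => x _.
  rewrite /= !patchE; case: ifPn => [/set_mem Dx|_] /=.
    by rewrite ger0_norm// mulr_ge0 ?u0 ?v0.
  by rewrite mulr0 normr0.
move=> h.
apply: (le_trans (ge0_lee_poweR (ltW p0) _ h)).
  by apply: integral_ge0 => x Dx; rewrite lee_fin mulr_ge0 ?u0 ?v0.
have I0 : (0 <= \int[mu]_(x in D) (v x `^ p)%:E)%E.
  by apply: integral_ge0 => x _; rewrite lee_fin powR_ge0.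
rewrite poweRM ?poweR_ge0// -!poweRrM mulVf ?gt_eqF// poweRe1//.
by rewrite p'E mulrBl mul1r mulVf// gt_eqF.
Qed.

End Lnorm_restrict.

Section exponential_average.
Context {R : realType}.
Variables (p p' : R).
Hypotheses (p_gt1 : 1 < p) (pp' : p^-1 + p'^-1 = 1).
Local Notation leb := (@lebesgue_measure R).
Local Notation H := (@halfline R).

Lemma halflineP (t : R) : H t -> 0 < t.
Proof. by rewrite /halfline/= in_itv/= andbT. Qed.

(** Split e^(-l t) g as u v, where u = (l t)^(-1/(2p')) e^(-l t / p') and v
    = (l t)^(1/(2p')) e^(-l t / p) g. Then u^p' = (l t)^(-1/2) e^(-l t) has
    integral at most 4 / l, and v^p is the profile times g^p. Any power
    between 0 and 1 would do in place of 1/2; this one has an elementary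
    primitive. *)
Lemma integral_exp_average_le (g : R -> R) (l : R) : 0 < l ->
  measurable_fun H g -> (forall t, H t -> 0 <= g t) ->
  ((\int[leb]_(t in H) (expR (- (l * t)) * g t)%:E) `^ p <=
   ((4 / l) `^ (p - 1))%:E *
   \int[leb]_(t in H) (gamma_profile ((p - 1) / 2) (l * t) * g t `^ p)%:E)%E.
Proof.
move=> l0 mg g0.
have p0 : 0 < p by rewrite (lt_trans _ p_gt1).
have p'E : p'^-1 = 1 - p^-1 by rewrite -pp' addrC addKr.
have p'0 : 0 < p' by rewrite -invr_gt0 p'E subr_gt0 invf_lt1.
have mH : measurable H by exact: measurable_itv.
pose u (t : R) := (l * t) `^ (- (2 * p')^-1) * expR (- (l * t) / p').
pose v (t : R) := (l * t) `^ ((2 * p')^-1) * expR (- (l * t) / p) * g t.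
have mlt : measurable_fun setT (fun t : R => l * t) by exact: mulrl_measurable.
have mexp (c : R) : measurable_fun setT (fun t : R => expR (- (l * t) / c)).
  apply: measurableT_comp => //; apply: measurable_funM => //.
  exact: measurable_funN.
have mpow (c : R) : measurable_fun setT (fun t : R => (l * t) `^ c).
  exact: (measurableT_comp (measurable_powR c)).
have mu_ : measurable_fun H u.
  by apply: measurable_funTS; apply: measurable_funM.
have mv : measurable_fun H v.
  by apply: measurable_funM => //; apply: measurable_funTS; apply: measurable_funM.
have u0 t : H t -> 0 <= u t by move=> _; rewrite mulr_ge0 ?powR_ge0 ?expR_ge0.
have v0 t : H t -> 0 <= v t.
  by move=> Ht; rewrite !mulr_ge0 ?powR_ge0 ?expR_ge0 ?g0.
have lt0 t : H t -> 0 < l * t by move=> /halflineP t0; rewrite mulr_gt0.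
have := hoelder_powR leb p_gt1 pp' mH mu_ mv u0 v0.
rewrite (_ : \int[leb]_(x in H) (u x * v x)%:E =
  \int[leb]_(t in H) (expR (- (l * t)) * g t)%:E)%E; last first.
  apply: eq_integral => t /set_mem Ht; congr EFin.
  have -> : expR (- (l * t)) = expR (- (l * t) / p) * expR (- (l * t) / p').
    by rewrite -expRD -mulrDr pp' mulr1.
  rewrite /u /v powRN; field.
  by rewrite gt_eqF ?powR_gt0 ?lt0.
rewrite (_ : \int[leb]_(x in H) (v x `^ p)%:E = \int[leb]_(t in H)
  (gamma_profile ((p - 1) / 2) (l * t) * g t `^ p)%:E)%E; last first.
  apply: eq_integral => t /set_mem Ht; congr EFin.
  rewrite /v /gamma_profile !(@powRM _ _ _ p) ?mulr_ge0 ?powR_ge0 ?expR_ge0 ?g0//.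
  rewrite -powRrM -expRM divfK ?gt_eqF//; congr (_ `^ _ * _ * _).
  rewrite invfM p'E; field; exact: lt0r_neq0.
move=> /le_trans; apply; apply: lee_wpmul2r.
  apply: integral_ge0 => t Ht; rewrite lee_fin mulr_ge0 ?powR_ge0//.
  exact: gamma_profile_ge0.
rewrite -poweR_EFin.
apply: ge0_lee_poweR; rewrite ?subr_ge0 ?(ltW p_gt1)//.
  by apply: integral_ge0 => t _; rewrite lee_fin powR_ge0.
rewrite (_ : \int[leb]_(x in H) (u x `^ p')%:E = (l `^ (- 2^-1))%:E *
  \int[leb]_(t in H) (expR (- (l * t)) * t `^ (- 2^-1))%:E)%E; last first.
  rewrite -ge0_integralZl//=.
  - apply: eq_integral => t /set_mem Ht; rewrite -EFinM; congr EFin.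
    rewrite /u powRM ?powR_ge0 ?expR_ge0// -powRrM -expRM divfK ?gt_eqF//.
    rewrite mulrCA mulrC -powRM ?(ltW l0) ?(ltW (halflineP Ht))//.
    congr (_ * _ `^ _).
    by field; exact: lt0r_neq0.
  - apply/measurable_EFinP; apply: measurable_funM.
      exact: measurable_expRN.
    exact: (measurable_funTS (measurable_powR _)).
  - by move=> t _; rewrite lee_fin mulr_ge0 ?expR_ge0 ?powR_ge0.
  - by rewrite lee_fin powR_ge0.
apply: (@le_trans _ _ ((l `^ (- 2^-1))%:E * (4 * l `^ (- 2^-1))%:E)%E).
  rewrite lee_wpmul2l ?lee_fin ?powR_ge0//.
  exact: integral_expRN_powRNhalf_le.
rewrite -EFinM lee_fin mulrCA -powRD; last by rewrite (gt_eqF l0) implybT.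
by have -> : - 2^-1 - 2^-1 = -1 :> R; [field|rewrite powR_inv1// ltW].
Qed.

End exponential_average.

(** * Pointwise bounds on the Laplace transform *)

Section cLnorm_theory.
Context d (T : measurableType d) (R : realType).
Variables (mu : {measure set T -> \bar R}) (D : set T).
Implicit Types (f : T -> R[i]) (p : R).
Local Notation normc := ComplexField.Normc.normc.

Lemma cLnormE f p : p != 0 ->
  cLnorm mu D p f =
  ((\int[mu]_(x in D) (normc (f x) `^ p)%:E) `^ p^-1)%E.
Proof.
by move=> p0; rewrite -Lnorm_restrict_EFin// => x _; exact: normc_ge0.
Qed.

Lemma in_cLp_integral f p : 0 < p -> in_cLp mu D p f ->
  exists2 N : R, 0 <= N &
    (\int[mu]_(x in D) (normc (f x) `^ p)%:E = N%:E)%E.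
Proof.
move=> p0 [_]; rewrite cLnormE ?gt_eqF// => /lty_poweRy.
rewrite invr_neq0 ?gt_eqF// => /(_ isT).
set I := integral _ _ _ => Ioo.
have I0 : (0 <= I)%E by apply: integral_ge0 => x _; rewrite lee_fin powR_ge0.
exists (fine I); first exact: fine_ge0.
by rewrite fineK// ge0_fin_numE.
Qed.

Lemma measurable_normc_comp (f : T -> borelC R) :
  measurable_fun D f -> measurable_fun D (fun x => normc (f x)).
Proof. exact: (measurableT_comp measurable_normc). Qed.

End cLnorm_theory.

Section laplace_bound.
Context {R : realType}.
Variables (p p' : R).
Hypotheses (p_gt1 : 1 < p) (pp' : p^-1 + p'^-1 = 1).
Implicit Types (f : R -> R[i]) (s : R[i]) (l : R).
Local Notation normc := ComplexField.Normc.normc.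
Local Notation leb := (@lebesgue_measure R).
Local Notation H := (@halfline R).

(** The energy E(l) of the opening comment. Summed over dyadic l it is
    controlled by the p-th power of the norm of f, which replaces a
    pointwise bound on each transform. *)
Definition gamma_energy f l : \bar R :=
  \int[leb]_(t in H) (gamma_profile ((p - 1) / 2) (l * t) *
                      normc (f t) `^ p)%:E.

Let p0 : 0 < p. Proof. exact: lt_trans p_gt1. Qed.
Let al0 : 0 < (p - 1) / 2. Proof. by rewrite divr_gt0// subr_gt0. Qed.

Lemma gamma_energy_ge0 f l : (0 <= gamma_energy f l)%E.
Proof.
apply: integral_ge0 => t _.
by rewrite lee_fin mulr_ge0 ?gamma_profile_ge0 ?powR_ge0.
Qed.

Lemma measurable_powR_normc f (q : R) : measurable_fun H (f : R -> borelC R) ->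
  measurable_fun H (fun t => normc (f t) `^ q).
Proof.
move=> mf; apply: (measurableT_comp (measurable_powR q)).
exact: measurable_normc_comp.
Qed.

Lemma measurable_gamma_energy f l : measurable_fun H (f : R -> borelC R) ->
  measurable_fun H (fun t => (gamma_profile ((p - 1) / 2) (l * t) *
                      normc (f t) `^ p)%:E).
Proof.
move=> mf; apply/measurable_EFinP; apply: measurable_funM.
  apply: measurableT_comp; last exact: mulrl_measurable.
  exact: measurable_gamma_profile.
exact: measurable_powR_normc.
Qed.

Lemma sum_gamma_energy_le : exists2 c : R, 0 < c &
  forall f n l, 0 < l -> measurable_fun H (f : R -> borelC R) ->
    (\sum_(i < n) gamma_energy f (2 ^+ i * l) <=
     c%:E * \int[leb]_(t in H) (normc (f t) `^ p)%:E)%E.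
Proof.
have [c c0 hc] := sum_gamma_profile_dyadic_le al0; exists c => // f n l l0 mf.
have mH : measurable H by exact: measurable_itv.
have ph0 i t : (0 <= (gamma_profile ((p - 1) / 2) (2 ^+ i * l * t) *
                      normc (f t) `^ p)%:E)%E.
  by rewrite lee_fin mulr_ge0 ?gamma_profile_ge0 ?powR_ge0.
rewrite -ge0_integral_sum//; last by move=> i; exact: measurable_gamma_energy.
rewrite -ge0_integralZl//=; last 3 first.
- apply/measurable_EFinP; exact: measurable_powR_normc.
- by move=> t _; rewrite lee_fin powR_ge0.
- by rewrite lee_fin ltW.
apply: ge0_le_integral => //.
- by move=> t _; apply: sume_ge0 => i _; exact: ph0.
- by apply: emeasurable_sum => i; exact: measurable_gamma_energy.
- apply: measurable_funeM; apply/measurable_EFinP; exact: measurable_powR_normc.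
move=> t /halflineP t0; rewrite sumEFin -EFinM lee_fin -mulr_suml.
rewrite ler_wpM2r ?powR_ge0//.
under eq_bigr do rewrite -mulrA.
by apply: hc; rewrite mulr_gt0.
Qed.

Lemma gamma_energy_le : exists2 c : R, 0 < c &
  forall f l, 0 < l -> measurable_fun H (f : R -> borelC R) ->
    (gamma_energy f l <=
     c%:E * \int[leb]_(t in H) (normc (f t) `^ p)%:E)%E.
Proof.
have [c c0 hc] := sum_gamma_energy_le; exists c => // f l l0 mf.
by have := hc f 1 l l0 mf; rewrite big_ord1 expr0 mul1r.
Qed.

(** The average is finite because its p-th power is bounded by a multiple of
    the energy. *)
Lemma integral_exp_average_lty f l : 0 < l -> Lp_halfline p f ->
  (\int[leb]_(t in H) (expR (- (l * t)) * normc (f t))%:E < +oo)%E.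
Proof.
move=> l0 fp; have [mf _] := fp.
have [c c0 hc] := gamma_energy_le.
have [N N0 NE] := in_cLp_integral p0 fp.
apply: (@lty_poweRy _ _ p); first by rewrite gt_eqF.
apply: (le_lt_trans (integral_exp_average_le p_gt1 pp' l0
  (measurable_normc_comp mf) (fun t _ => normc_ge0 (f t)))).
apply: (@le_lt_trans _ _ (((4 / l) `^ (p - 1))%:E * (c%:E * N%:E))%E).
  by rewrite lee_wpmul2l ?lee_fin ?powR_ge0// -NE; exact: hc.
by rewrite -!EFinM ltry.
Qed.

Lemma expfun_mul_norm_le s l t (w : R[i]) : l <= complex.Re s -> 0 < t ->
  normc (expfun s t * w) <= expR (- (l * t)) * normc w.
Proof.
move=> ls t0; rewrite ComplexField.Normc.normcM normc_expfun.
by rewrite ler_wpM2r ?normc_ge0// ler_expR lerN2 ler_wpM2r// ltW.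
Qed.

Lemma integrable_exp_average f l : 0 < l -> Lp_halfline p f ->
  leb.-integrable H (EFin \o (fun t => expR (- (l * t)) * normc (f t))).
Proof.
move=> l0 fp; have [mf _] := fp; apply/integrableP; split.
  apply/measurable_EFinP; apply: measurable_funM.
    exact: measurable_expRN.
  exact: measurable_normc_comp.
under eq_integral do rewrite /= ger0_norm ?mulr_ge0 ?expR_ge0 ?normc_ge0//.
exact: integral_exp_average_lty.
Qed.

Lemma Lp_laplace_defined f s : 0 < complex.Re s -> Lp_halfline p f ->
  laplace_defined f s.
Proof.
move=> s0 fp; have [mf _] := fp.
have mH : measurable H by exact: measurable_itv.
have mg := measurable_expfun_mul s mf.
have ig := integrable_exp_average s0 fp.
split; (apply: le_integrable ig => //=;
  [apply/measurable_EFinP|move=> t /halflineP t0]).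
- exact: measurable_Re_comp.
- rewrite lee_fin [leRHS]ger0_norm ?mulr_ge0 ?expR_ge0 ?normc_ge0//.
  apply: (le_trans (ler_norm_Re_normc _)); exact: expfun_mul_norm_le.
- exact: measurable_Im_comp.
- rewrite lee_fin [leRHS]ger0_norm ?mulr_ge0 ?expR_ge0 ?normc_ge0//.
  apply: (le_trans (ler_norm_Im_normc _)); exact: expfun_mul_norm_le.
Qed.

(** The factor 2 comes from estimating real and imaginary part separately. *)
Lemma normc_laplace_le f s l : 0 < l -> l <= complex.Re s -> Lp_halfline p f ->
  normc (laplace f s) <=
  2 * \int[leb]_(t in H) (expR (- (l * t)) * normc (f t)).
Proof.
move=> l0 ls fp; have [mf _] := fp.
have mH : measurable H by exact: measurable_itv.
have s0 := lt_le_trans l0 ls.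
have [ire iim] := Lp_laplace_defined s0 fp.
have ig := integrable_exp_average l0 fp.
have bound (g : R -> R) : leb.-integrable H (EFin \o g) ->
    (forall t, H t -> `|g t| <= expR (- (l * t)) * normc (f t)) ->
    `|\int[leb]_(t in H) g t| <=
    \int[leb]_(t in H) (expR (- (l * t)) * normc (f t)).
  move=> ig' gb; apply: (@le_trans _ _ (\int[leb]_(t in H) `|g t|)).
    exact: le_normr_Rintegral.
  by apply: le_Rintegral => //; exact: integrable_norm.
apply: (le_trans (ler_normc_ReDIm _)); rewrite mulr_natl mulr2n lerD//=.
  apply: bound => // t /halflineP t0.
  apply: (le_trans (ler_norm_Re_normc _)); exact: expfun_mul_norm_le.
apply: bound => // t /halflineP t0.
apply: (le_trans (ler_norm_Im_normc _)); exact: expfun_mul_norm_le.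
Qed.

Lemma powR_normc_laplace_le f s l : 0 < l -> l <= complex.Re s ->
  Lp_halfline p f ->
  ((normc (laplace f s) `^ p)%:E <=
   (2 `^ p * (4 / l) `^ (p - 1))%:E * gamma_energy f l)%E.
Proof.
move=> l0 ls fp; have [mf _] := fp.
rewrite EFinM -muleA.
apply: (@le_trans _ _ ((2 `^ p)%:E *
  (\int[leb]_(t in H) (expR (- (l * t)) * normc (f t))%:E) `^ p)%E); last first.
  rewrite lee_wpmul2l ?lee_fin ?powR_ge0//.
  exact: (integral_exp_average_le p_gt1 pp' l0
    (measurable_normc_comp mf) (fun t _ => normc_ge0 (f t))).
have X0 : (0 <= \int[leb]_(t in H) (expR (- (l * t)) * normc (f t))%:E)%E.
  by apply: integral_ge0 => t _; rewrite lee_fin mulr_ge0 ?expR_ge0 ?normc_ge0.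
have XE : (\int[leb]_(t in H) (expR (- (l * t)) * normc (f t))%:E)%E \is a fin_num.
  by rewrite ge0_fin_numE// integral_exp_average_lty.
rewrite -(fineK XE) poweR_EFin -EFinM lee_fin -powRM ?fine_ge0//.
rewrite ge0_ler_powR ?(ltW p0) ?nnegrE ?normc_ge0 ?mulr_ge0 ?fine_ge0//.
exact: normc_laplace_le.
Qed.

End laplace_bound.

(** * From boxes to the embedding *)

Section strips.
Context {R : realType}.
Variables (mu : {measure set (borelC R) -> \bar R}) (S : set (borelC R)).
Hypotheses (mS : measurable S) (SCplus : S `<=` Cplus R).

Definition strip (a b : R) : set (borelC R) :=
  S `&` [set z | complex.Re z \in `[a, b[].

Lemma measurable_strip a b : measurable (strip a b).
Proof. by apply: measurableI => //; exact: measurable_Re_itv. Qed.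

(** Each step splits off the topmost dyadic strip, so the strips need not be
    indexed by all integers. *)
Lemma integral_strip_dyadic (g : borelC R -> \bar R) (a : R) n : 0 < a ->
  measurable_fun S g -> (forall s, S s -> 0 <= g s)%E ->
  (\int[mu]_(s in strip a (2 ^+ n * a)) g s =
   \sum_(i < n) \int[mu]_(s in strip (2 ^+ i * a) (2 * (2 ^+ i * a))) g s)%E.
Proof.
move=> a0 mg g0; elim: n => [|n IH].
  rewrite big_ord0 expr0 mul1r (_ : strip a a = set0) ?integral_set0//.
  by rewrite -subset0 => z [_] /=; rewrite in_itv/= => /andP[/le_lt_trans h /h];
    rewrite ltxx.
rewrite big_ord_recr/= -IH exprS -mulrA.
have a1 : a <= 2 ^+ n * a by rewrite ler_peMl ?(ltW a0)// exprn_ege1// ler1n.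
have a2 : 2 ^+ n * a <= 2 * (2 ^+ n * a).
  by rewrite ler_peMl ?ler1n// (le_trans (ltW a0)).
rewrite -ge0_integral_setU.
- congr integral; apply/seteqP; split=> z; rewrite /strip/= !in_itv/=.
    move=> [Sz /andP[z1 z2]]; have [zn|zn] := ltP (complex.Re z) (2 ^+ n * a).
      by left; rewrite z1.
    by right; rewrite z2.
  by move=> [[Sz /andP[z1 z2]]|[Sz /andP[z1 z2]]]; split=> //; lra.
- exact: measurable_strip.
- exact: measurable_strip.
- by apply: measurable_funS mg => // z [[]|[]].
- by move=> z [[Sz _]|[Sz _]]; exact: g0.
- apply/disj_setPS => z [[_ /=]] + [_ /=]; rewrite !in_itv/=; lra.
Qed.

Lemma bigcup_strip :
  \bigcup_N strip (2 ^+ N)^-1 (2 ^+ N.*2 * (2 ^+ N)^-1) = S.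
Proof.
apply/seteqP; split=> [z [N _ []]//|z Sz].
have x0 : 0 < complex.Re z := SCplus Sz.
have lt2 (y : R) n : 0 <= y -> (Num.bound y <= n)%N -> y < 2 ^+ n.
  move=> y0 yn; apply: (lt_le_trans (archi_boundP y0)).
  by rewrite -natrX ler_nat (leq_trans yn)// ltnW// ltn_expl.
exists (maxn (Num.bound (complex.Re z)) (Num.bound (complex.Re z)^-1)) => //.
set N := maxn _ _; split=> //=; rewrite in_itv/=.
have xN := lt2 _ N (ltW x0) (leq_maxl _ _).
have xVN : (complex.Re z)^-1 < 2 ^+ N.
  by apply: lt2; rewrite ?leq_maxr// invr_ge0 ltW.
rewrite -addnn exprD mulfK ?expf_neq0// xN andbT.
by rewrite -[leRHS]invrK lef_pV2 ?posrE ?exprn_gt0 ?invr_gt0// ltW.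
Qed.

(** The windows from 2^-N to 2^N exhaust [S]. *)
Lemma ge0_integral_le_dyadic (g : borelC R -> \bar R) (B : \bar R) :
  measurable_fun S g -> (forall s, S s -> 0 <= g s)%E ->
  (forall a n, 0 < a ->
    (\sum_(i < n) \int[mu]_(s in strip (2 ^+ i * a) (2 * (2 ^+ i * a))) g s
      <= B)%E) ->
  (\int[mu]_(s in S) g s <= B)%E.
Proof.
move=> mg g0 hB; rewrite -bigcup_strip.
apply: ge0_integral_bigcup_nondecreasing_le.
- move=> m n mn; rewrite subsetEset => z; rewrite /strip/= !in_itv/=.
  move=> [Sz /andP[z1 z2]]; split=> //.
  rewrite -!addnn !exprD !mulfK ?expf_neq0// in z2 *.
  have mn2 : 2 ^+ m <= 2 ^+ n :> R by rewrite ler_weXn2l// ler1n.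
  rewrite (lt_le_trans z2 mn2) andbT; apply: le_trans z1.
  by rewrite lef_pV2 ?posrE ?exprn_gt0.
- by move=> N; exact: measurable_strip.
- by move=> N; apply: measurable_funS mg => // z [].
- by move=> N z [Sz _]; exact: g0.
move=> N; rewrite integral_strip_dyadic ?invr_gt0 ?exprn_gt0//.
by apply: hB; rewrite invr_gt0 exprn_gt0.
Qed.

End strips.

Section embedding.
Context {R : realType}.
Variables (theta : R) (mu : {measure set (borelC R) -> \bar R}) (p p' q C : R).
Hypotheses (theta_gt0 : 0 < theta) (theta_lt : theta < pi / 2).
Hypothesis mu_supp : mu (~` sector theta) = 0%E.
Hypotheses (p_gt1 : 1 < p) (le_pq : p <= q) (pp' : p^-1 + p'^-1 = 1).
Hypothesis C_gt0 : 0 < C.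
Hypothesis mu_box : forall J : interval R,
  bounded_set [set` J] -> (forall y : R, (- y \in J) = (y \in J)) ->
  (mu (Qbox J) <= (C * length J `^ (q / p'))%:E)%E.
Implicit Types (f : R -> R[i]) (l : R).
Local Notation normc := ComplexField.Normc.normc.
Local Notation leb := (@lebesgue_measure R).
Local Notation H := (@halfline R).

Let p0 : 0 < p. Proof. exact: lt_trans p_gt1. Qed.
Let q0 : 0 < q. Proof. exact: lt_le_trans le_pq. Qed.
Let cos0 : 0 < cos theta.
Proof.
by rewrite cos_gt0_pihalf// theta_lt andbT (lt_trans _ theta_gt0)// oppr_lt0
  divr_gt0 ?pi_gt0.
Qed.
Let theta_itv : 0 < theta < pi / 2. Proof. by rewrite theta_gt0. Qed.

Lemma length_itvcc (M : R) : 0 < M -> length `[- M, M] = 2 * M.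
Proof.
move=> M0; rewrite /length lebesgue_measure_itv/= lte_fin.
by rewrite gtrN// -EFinB/= opprK mulr_natl mulr2n.
Qed.

(** On this strip |Im s| <= |s| < 2 l / cos theta, so the symmetric box of
    that half-width contains it. *)
Lemma measure_sector_strip_le l : 0 < l ->
  (mu (strip (sector theta) l (2 * l)) <=
   (C * (4 * l / cos theta) `^ (q / p'))%:E)%E.
Proof.
move=> l0; pose M := 2 * l / cos theta.
have M0 : 0 < M by rewrite divr_gt0// mulr_gt0.
have -> : 4 * l / cos theta = length `[- M, M].
  by rewrite length_itvcc// /M; field; exact: lt0r_neq0.
apply: le_trans (mu_box _ _); last 2 first.
- exact/compact_bounded/segment_compact.
- by move=> y; rewrite !in_itv/= lerN2 lerNl andbC.
apply: le_measure; rewrite ?inE.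
- exact: (measurable_strip (measurable_sector theta_itv)).
- exact: measurable_Qbox.
move=> z [+ /=]; rewrite sectorE// in_itv/= => -[z0 /= zc] /andP[z1 z2].
have zM : normc z < M by rewrite /M ltr_pdivlMr// mulrC (lt_trans zc).
split.
  rewrite in_itv/= -ler_norml (le_trans (ler_norm_Im_normc z))//; exact: ltW.
rewrite length_itvcc// z0/= (le_lt_trans (ler_norm _))//.
rewrite (le_lt_trans (ler_norm_Re_normc z))// (lt_le_trans zM)//.
by rewrite ler_peMl ?ler1n// ltW.
Qed.

(** Because h^(q/p) <= h M^(q/p - 1) when 0 <= h <= M, the estimate can be
    kept linear in the energy, which is what can be summed over strips; here
    q >= p is used. The powers of [l] cancel since (p - 1) q / p = q / p'. *)
Lemma integral_laplace_strip_le : exists2 K : R, 0 < K &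
  forall f l (M : R), 0 < l -> Lp_halfline p f ->
  (gamma_energy p f l <= M%:E)%E ->
  (\int[mu]_(s in strip (sector theta) l (2 * l))
     (normc (laplace f s) `^ q)%:E <=
   (K * M `^ (q / p - 1))%:E * gamma_energy p f l)%E.
Proof.
exists ((2 `^ p) `^ (q / p) * C * (16 / cos theta) `^ (q / p')).
  by rewrite !mulr_gt0 ?powR_gt0// divr_gt0.
move=> f l M l0 fp HM; have [mf _] := fp.
have mst : measurable (strip (sector theta) l (2 * l)).
  exact: (measurable_strip (measurable_sector theta_itv)).
have h0 := gamma_energy_ge0 p f l.
have hfin : gamma_energy p f l \is a fin_num.
  by rewrite ge0_fin_numE// (le_lt_trans HM) ?ltry.
rewrite -(fineK hfin) in HM h0 *; set h := fine _ in HM h0 *.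
rewrite !lee_fin in HM h0.
have qp1 : 0 <= q / p - 1 by rewrite subr_ge0 ler_pdivlMr// mul1r.
have qp0 : 0 < q / p by rewrite divr_gt0.
have l40 : 0 < 4 / l by rewrite divr_gt0.
have r_eq : (p - 1) * (q / p) = q / p'.
  have -> : p'^-1 = 1 - p^-1 by rewrite -pp' addrC addKr.
  by field; exact: lt0r_neq0.
(* The supremum of |Lf|^q over the strip is at most B. *)
pose B : R := (2 `^ p) `^ (q / p) * (4 / l) `^ (q / p') * (h * M `^ (q / p - 1)).
have B0 : 0 <= B by rewrite !mulr_ge0 ?powR_ge0.
apply: (@le_trans _ _ 
  (\int[mu]_(s in strip (sector theta) l (2 * l)) (cst B%:E s))%E).
  apply: ge0_le_integral => //.
  - by move=> s _; rewrite lee_fin powR_ge0.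
  - apply/measurable_EFinP; apply: (measurableT_comp (measurable_powR q)).
    by apply: measurable_normc_comp; exact: measurable_laplace.
  move=> s [_ /=]; rewrite in_itv/= => /andP[ls _].
  have := powR_normc_laplace_le p_gt1 pp' l0 ls fp.
  rewrite -(fineK hfin) -/h -EFinM !lee_fin => Lp.
  have -> : normc (laplace f s) `^ q = (normc (laplace f s) `^ p) `^ (q / p).
    by rewrite -powRrM mulrC divfK// gt_eqF.
  apply: (@le_trans _ _ ((2 `^ p * (4 / l) `^ (p - 1) * h) `^ (q / p))).
    by rewrite ge0_ler_powR ?(ltW qp0) ?nnegrE ?mulr_ge0 ?powR_ge0.
  rewrite !(@powRM _ _ _ (q / p)) ?mulr_ge0 ?powR_ge0// -(powRrM (4 / l)) r_eq.
  rewrite ler_wpM2l ?mulr_ge0 ?powR_ge0//.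
  rewrite -(mulr_powRB1 h0 qp0) ler_wpM2l//.
  by rewrite ge0_ler_powR ?nnegrE// (le_trans h0).
rewrite integral_cst//.
apply: (@le_trans _ _ (B%:E * (C * (4 * l / cos theta) `^ (q / p'))%:E)%E).
  by rewrite lee_wpmul2l ?lee_fin//; exact: measure_sector_strip_le.
rewrite -!EFinM lee_fin.
have -> : (16 / cos theta) `^ (q / p') =
    (4 / l) `^ (q / p') * (4 * l / cos theta) `^ (q / p').
  rewrite -powRM ?(ltW l40)//; last by rewrite divr_ge0 ?mulr_ge0 ?ltW.
  by congr (_ `^ _); field; rewrite !gt_eqF.
by rewrite /B le_eqVlt; apply/orP; left; apply/eqP; ring.
Qed.

(** The bound [M] on each energy and the bound on their sum are the same
    number c N, whence the final power q/p of the norm. *)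
Lemma integral_laplace_le : exists2 K : R, 0 < K &
  forall f, Lp_halfline p f ->
  (\int[mu]_(s in Cplus R) (normc (laplace f s) `^ q)%:E <=
   K%:E * (\int[leb]_(t in H) (normc (f t) `^ p)%:E) `^ (q / p))%E.
Proof.
have [K K0 hK] := integral_laplace_strip_le.
have [c c0 hc] := sum_gamma_energy_le p_gt1.
exists (K * c `^ (q / p)); first by rewrite mulr_gt0 ?powR_gt0.
move=> f fp; have [mf _] := fp.
have [N N0 NE] := in_cLp_integral p0 fp.
have mL (D : set (borelC R)) :
    measurable_fun D (fun s => (normc (laplace f s) `^ q)%:E).
  apply/measurable_EFinP; apply: (measurableT_comp (measurable_powR q)).
  by apply: measurable_normc_comp; exact: measurable_laplace.
have L0 s : (0 <= (normc (laplace f s) `^ q)%:E)%E by rewrite lee_fin powR_ge0.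
have msec := measurable_sector theta_itv.
have mNsec : measurable (~` sector theta : set (borelC R)) by exact: measurableC.
(* Off the sector mu vanishes. *)
rewrite (ge0_negligible_integral mNsec measurable_Cplus (mL _) _ mu_supp)//.
rewrite setDE setCK (_ : _ `&` _ = sector theta); last first.
  by apply/seteqP; split=> [z []//|z Sz]; split=> //; case: Sz.
rewrite NE poweR_EFin.
have qp0 : 0 < q / p by rewrite divr_gt0.
apply: ge0_integral_le_dyadic => //; first by move=> z [].
move=> a n a0.
have sum_le : (\sum_(i < n) gamma_energy p f (2 ^+ i * a) <= (c * N)%:E)%E.
  by rewrite EFinM -NE; exact: hc.
apply: (@le_trans _ _ (\sum_(i < n)
    (K * (c * N) `^ (q / p - 1))%:E * gamma_energy p f (2 ^+ i * a))%E).
  apply: lee_sum => i _; apply: hK => //; first by rewrite mulr_gt0 ?exprn_gt0.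
  have := hc f 1 (2 ^+ i * a); rewrite big_ord1 expr0 mul1r EFinM -NE; apply=> //.
  by rewrite mulr_gt0 ?exprn_gt0.
rewrite -ge0_sume_distrr; last by move=> i _; exact: gamma_energy_ge0.
apply: (@le_trans _ _ ((K * (c * N) `^ (q / p - 1))%:E * (c * N)%:E)%E).
  by rewrite lee_wpmul2l// lee_fin mulr_ge0 ?powR_ge0 ?(ltW K0).
have cN0 : 0 <= c * N by rewrite mulr_ge0 ?(ltW c0).
rewrite -!EFinM lee_fin mulrAC -[leLHS]mulrA (mulr_powRB1 cN0 qp0).
by rewrite powRM ?(ltW c0)// mulrA.
Qed.

Lemma laplace_embedding_of_box : laplace_embedding_well_defined mu p q /\
  laplace_embedding_bounded mu p q.
Proof.
have [K K0 hK] := integral_laplace_le.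
have bounded f : Lp_halfline p f ->
    (cLnorm mu (Cplus R) q (laplace f) <=
     (K `^ q^-1)%:E * norm_halfline p f)%E.
  move=> fp; rewrite /norm_halfline !cLnormE ?gt_eqF//.
  set I := (\int[mu]_(x in _) _)%E; set N := (\int[leb]_(x in _) _)%E.
  have I0 : (0 <= I)%E by apply: integral_ge0 => x _; rewrite lee_fin powR_ge0.
  have -> : p^-1 = q / p * q^-1 by field; rewrite !gt_eqF.
  rewrite poweRrM -poweR_EFin -poweRM ?lee_fin ?poweR_ge0 ?(ltW K0)//.
  apply: ge0_lee_poweR; rewrite ?invr_ge0 ?(ltW q0)//.
  exact: hK.
split; last by exists (K `^ q^-1) => //; rewrite powR_gt0.
move=> f fp; have [mf flty] := fp; split.
  by move=> s s0; exact: (Lp_laplace_defined p_gt1 pp').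
split; first exact: measurable_laplace.
apply: le_lt_trans (bounded f fp) _.
by rewrite lte_mul_pinfty ?lee_fin ?powR_ge0.
Qed.

End embedding.

(** * From exponentials to boxes *)

Section test_functions.
Context {R : realType}.
Implicit Types (p q z w : R) (s : R[i]).
Local Notation normc := ComplexField.Normc.normc.
Local Notation leb := (@lebesgue_measure R).
Local Notation H := (@halfline R).

Lemma norm_expfun p z : 0 < p -> 0 < z ->
  norm_halfline p (expfun z%:C) = (((p * z)^-1) `^ p^-1)%:E.
Proof.
move=> p0 z0; rewrite /norm_halfline cLnormE ?gt_eqF// -poweR_EFin.
rewrite -integral_expRN ?mulr_gt0//; congr (_ `^ _)%E.
apply: eq_integral => t _; rewrite normc_expfun /= -expRM; congr (expR _)%:E.
ring.
Qed.

Lemma Lp_expfun p z : 0 < p -> 0 < z -> Lp_halfline p (expfun z%:C).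
Proof.
move=> p0 z0; split; first exact: measurable_expfun.
by have := norm_expfun p0 z0; rewrite /norm_halfline => ->; exact: ltry.
Qed.

Lemma integrable_expRN w : 0 < w ->
  leb.-integrable H (EFin \o (fun t => expR (- (w * t)))).
Proof.
move=> w0; apply/integrableP; split.
  by apply/measurable_EFinP; exact: measurable_expRN.
under eq_integral do rewrite /= ger0_norm ?expR_ge0//.
by rewrite integral_expRN ?ltry.
Qed.

Lemma Rintegral_expRN w : 0 < w ->
  \int[leb]_(t in H) expR (- (w * t)) = w^-1.
Proof. by move=> w0; rewrite /Rintegral integral_expRN. Qed.

(** By [ler_2B_expR_cos] the real part is at least 2/w - 1/(w - |Im s|) with
    w = Re s + z, and |Im s| <= w/4. *)
Lemma normc_laplace_expfun_ge z s : 0 < z -> 0 < complex.Re s ->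
  4 * `|complex.Im s| <= complex.Re s + z ->
  2 / (3 * (complex.Re s + z)) <= normc (laplace (expfun z%:C) s).
Proof.
move=> z0 s0; set x := complex.Re s; set y := `|complex.Im s|; set w := x + z.
move=> yw.
have w0 : 0 < w by rewrite addr_gt0.
have y0 : 0 <= y by exact: normr_ge0.
have v0 : 0 < w - y by lra.
have mH : measurable H by exact: measurable_itv.
(* The exponential lies in L^2, which makes the Laplace integrand integrable. *)
have two1 : 1 < 2 :> R by rewrite ltr1n.
have twoE : 2^-1 + 2^-1 = 1 :> R by field.
have [ire _] := Lp_laplace_defined two1 twoE s0 (Lp_expfun (ltr0n R 2) z0).
apply: (le_trans _ (ler_norm_Re_normc _)).
apply: (le_trans _ (ler_norm _)).
rewrite [leRHS](_ : _ = \int[leb]_(t in H)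
  complex.Re (expfun s t * expfun z%:C t))//.
have iw := integrable_expRN w0.
have iv := integrable_expRN v0.
have i2w : leb.-integrable H (EFin \o (fun t => 2 * expR (- (w * t)))).
  exact: (@integrableZl _ _ _ leb _ mH 2 _ iw).
apply: (@le_trans _ _ (\int[leb]_(t in H)
    (2 * expR (- (w * t)) - expR (- ((w - y) * t))))).
  rewrite RintegralB// RintegralZl// !Rintegral_expRN//.
  have : (w - y)^-1 <= 4 / (3 * w).
    rewrite -[leLHS]mul1r ler_pdivrMr// mulrAC ler_pdivlMr ?mulr_gt0//; lra.
  have -> : 4 / (3 * w) = 2 * w^-1 - 2 / (3 * w) by field; exact: lt0r_neq0.
  lra.
apply: le_Rintegral => //; first exact: (@integrableB _ _ _ leb _ mH _ _ i2w iv).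
move=> t /halflineP t0; rewrite Re_expfun_mul -/x expfunE /=.
rewrite !mul0r oppr0 cos0 sin0 !(mulr0, mul0r, mulr1, subr0, oppr0, addr0).
have -> : expR (- (x * t)) * (cos (complex.Im s * t) * expR (- (z * t))) =
    expR (- (w * t)) * cos (complex.Im s * t).
  by rewrite /w mulrDl opprD expRD; ring.
have -> : expR (- ((w - y) * t)) = expR (- (w * t)) * expR (y * t).
  by rewrite -expRD; congr expR; ring.
rewrite [2 * _]mulrC -mulrBr ler_wpM2l ?expR_ge0//.
have yt0 : 0 <= y * t by rewrite mulr_ge0// ltW.
apply: (le_trans (ler_2B_expR_cos yt0)).
by rewrite /y -{1}(gtr0_norm t0) -normrM cos_norm.
Qed.

End test_functions.

Section symmetric_interval.
Context {R : realType}.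
Variable J : interval R.
Hypothesis J_bounded : bounded_set [set` J].

Lemma bounded_itv_length : (@lebesgue_measure R [set` J] = (length J)%:E)%E.
Proof.
have [M M0 hM] := pinfty_ex_gt0 J_bounded.
rewrite /length fineK// ge0_fin_numE//.
apply: (@le_lt_trans _ _ (@lebesgue_measure R `[- M, M])); last first.
  by rewrite lebesgue_measure_itv/= lte_fin; case: ifPn => _; rewrite -?EFinB ltry.
apply: le_measure; rewrite ?inE; try exact: measurable_itv.
by move=> y Jy /=; rewrite in_itv/= -ler_norml; exact: hM.
Qed.

(** A symmetric interval containing y contains [-|y|, |y|]. *)
Lemma symmetric_itv_le_length (y : R) :
  (forall y : R, (- y \in J) = (y \in J)) -> y \in J -> 2 * `|y| <= length J.
Proof.
move=> Jsym yJ; rewrite -lee_fin -bounded_itv_length.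
have [->|y0] := eqVneq y 0; first by rewrite normr0 mulr0.
have ny0 : 0 < `|y| by rewrite normr_gt0.
rewrite -(length_itvcc ny0) /length fineK; last first.
  by rewrite lebesgue_measure_itv/=; case: ifPn.
apply: le_measure; rewrite ?inE; try exact: measurable_itv.
have nyJ : `|y| \in J by case: (ger0P y) => _; rewrite ?Jsym.
have NnyJ : - `|y| \in J by rewrite Jsym.
move=> x /=; rewrite in_itv/=.
exact: (interval_is_interval NnyJ nyJ).
Qed.

End symmetric_interval.

(** The exponent is the integer part of the logarithm of x in base 2. *)
Lemma exists_dyadic_between (R : realType) (x : R) : 0 < x ->
  exists n : int, (2 : R) ^ n <= x < 2 * 2 ^ n.
Proof.
move=> x0; have ln20 : 0 < ln 2 :> R by rewrite ln_gt0// ltr1n.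
pose u := ln x / ln 2; have xE : x = 2 `^ u.
  rewrite /powR gt_eqF// /u divfK ?gt_eqF// lnK//.
exists (Num.floor u).
have /andP[f1 f2] := floor_itv u.
have two1 : 1 < 2 :> R by rewrite ltr1n.
rewrite -(powR_intmul _ (ltW (lt_trans ltr01 two1))) xE ler_powR ?(ltW two1)//=.
rewrite -{2}(powRr1 (ler0n R 2)) -powRD ?pnatr_eq0 ?implybT//.
rewrite /powR !gt_eqF// ltr_expR ltr_pM2r//.
by rewrite addrC -[1]/(1%:~R) -intrD.
Qed.

Section box_of_test.
Context {R : realType}.
Variables (mu : {measure set (borelC R) -> \bar R}) (p p' q C : R).
Hypotheses (p_gt1 : 1 < p) (le_pq : p <= q) (pp' : p^-1 + p'^-1 = 1).
Hypothesis C_gt0 : 0 < C.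
Hypothesis test : forall n : int,
  (cLnorm mu (Cplus R) q (laplace (expfun ((2 : R) ^ n)%:C))
    <= C%:E * norm_halfline p (expfun ((2 : R) ^ n)%:C))%E.
Local Notation normc := ComplexField.Normc.normc.

(** For a dyadic z between 2 L and 4 L the transform is at least 2 / (15 L)
    on the box, since there Re s + z <= 5 L and 4 |Im s| <= 2 L <= z. The
    constants of Chebyshev's inequality combine to 15 C / 2. *)
Lemma box_of_dyadic_test (J : interval R) :
  bounded_set [set` J] -> (forall y : R, (- y \in J) = (y \in J)) ->
  (mu (Qbox J) <= ((15 / 2 * C) `^ q * length J `^ (q / p'))%:E)%E.
Proof.
move=> Jb Js; set L := length J.
have p0 : 0 < p by exact: lt_trans p_gt1.
have q0 : 0 < q by exact: lt_le_trans le_pq.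
(* A degenerate interval has an empty box. *)
have [L0|L0] := leP L 0.
  rewrite (_ : Qbox J = set0) ?measure0 ?lee_fin ?mulr_ge0 ?powR_ge0//.
  rewrite -subset0 => z [_] /andP[z0 zL].
  by have := lt_le_trans (lt_trans z0 zL) L0; rewrite ltxx.
(* Rounding 4 L down to a power of 2 gives z with 2 L < z <= 4 L. *)
have L40 : 0 < 4 * L by rewrite mulr_gt0.
have [n /andP[n1 n2]] := exists_dyadic_between L40.
set z : R := 2 ^ n in n1 n2.
have z0 : 0 < z by rewrite /z exprz_gt0.
have a0 : 0 < 2 / (15 * L) by rewrite divr_gt0// mulr_gt0.
have mQ := measurable_Qbox J.
have mf (D : set (borelC R)) :
    measurable_fun D (fun s => (normc (laplace (expfun z%:C) s) `^ q)%:E).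
  apply/measurable_EFinP; apply: (measurableT_comp (measurable_powR q)).
  apply: measurable_normc_comp; apply: measurable_laplace.
  exact: measurable_expfun.
have step1 : (((2 / (15 * L)) `^ q)%:E * mu (Qbox J) <=
   \int[mu]_(s in Cplus R) (normc (laplace (expfun z%:C) s) `^ q)%:E)%E.
  rewrite -integral_cst//.
  apply: (@le_trans _ _
    (\int[mu]_(s in Qbox J) (normc (laplace (expfun z%:C) s) `^ q)%:E)%E).
    apply: ge0_le_integral => //; first by move=> s _; rewrite lee_fin powR_ge0.
    move=> s [sJ /andP[s0 sL]]; rewrite lee_fin.
    rewrite ge0_ler_powR ?(ltW q0) ?nnegrE ?normc_ge0 ?(ltW a0)//.
    have sy := symmetric_itv_le_length Jb Js sJ; rewrite -/L in sy.
    have yw : 4 * `|complex.Im s| <= complex.Re s + z by lra.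
    apply: (le_trans _ (normc_laplace_expfun_ge z0 s0 yw)).
    rewrite ler_pM2l// lef_pV2 ?posrE ?mulr_gt0 ?addr_gt0//.
    by rewrite -/L in sL; lra.
  apply: ge0_subset_integral => //.
  - exact: measurable_Cplus.
  - by move=> s _; rewrite lee_fin powR_ge0.
  - by move=> s [_ /andP[]].
have step2 : (\int[mu]_(s in Cplus R) (normc (laplace (expfun z%:C) s) `^ q)%:E
    <= ((C * (L^-1) `^ p^-1) `^ q)%:E)%E.
  set I := (\int[mu]_(s in _) _)%E.
  have I0 : (0 <= I)%E by apply: integral_ge0 => s _; rewrite lee_fin powR_ge0.
  have -> : I = ((I `^ q^-1) `^ q)%E.
    by rewrite -poweRrM mulVf ?gt_eqF// poweRe1.
  rewrite -poweR_EFin.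
  apply: ge0_lee_poweR; rewrite ?poweR_ge0 ?(ltW q0)//.
  rewrite -cLnormE ?gt_eqF//; apply: (le_trans (test n)).
  rewrite norm_expfun// -EFinM lee_fin ler_wpM2l ?(ltW C_gt0)//.
  rewrite ge0_ler_powR ?nnegrE ?invr_ge0 ?mulr_ge0 ?(ltW p0) ?(ltW z0) ?(ltW L0)//.
  rewrite lef_pV2 ?posrE ?mulr_gt0//; apply: (@le_trans _ _ z); first by lra.
  by rewrite ler_peMl ?(ltW z0) ?(ltW p_gt1).
have := le_trans step1 step2.
rewrite -lee_pdivlMl ?powR_gt0// => /le_trans; apply.
rewrite -EFinM lee_fin.
have p'E : q / p' = q - q / p.
  have -> : p'^-1 = 1 - p^-1 by rewrite -pp' addrC addKr.
  by rewrite mulrBr mulr1.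
have powRV (x r : R) : 0 <= x -> (x `^ r)^-1 = x^-1 `^ r.
  by move=> x0; rewrite -powRN -(powR_inv1 x0) -powRrM mulN1r.
have -> : ((2 / (15 * L)) `^ q)^-1 = (15 / 2) `^ q * L `^ q.
  rewrite powRV ?(ltW a0)// -powRM ?(ltW L0)//; congr (_ `^ _).
  by field; exact: lt0r_neq0.
have -> : (C * L^-1 `^ p^-1) `^ q = C `^ q / L `^ (q / p).
  rewrite powRM ?powR_ge0 ?(ltW C_gt0)// -powRrM -powRV ?(ltW L0)//.
  by rewrite [p^-1 * q]mulrC.
rewrite p'E powRB ?(gt_eqF L0) ?implybT// (@powRM _ _ C) ?(ltW C_gt0)//.
by rewrite le_eqVlt; apply/orP; left; apply/eqP; ring.
Qed.

End box_of_test.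

(** * The equivalence *)

Theorem theorem3p3 (R : realType) (theta : R)
    (mu : {measure set (borelC R) -> \bar R}) (p p' q : R)
    (theta_gt0 : 0 < theta) (theta_lt : theta < pi / 2)
    (mu_regular : regular_on (Cplus R) mu)
    (mu_supp : mu (~` sector theta) = 0%E)
    (p_gt1 : 1 < p) (le_pq : p <= q) (pp' : p^-1 + p'^-1 = 1) :
  [<-> laplace_embedding_well_defined mu p q /\
         laplace_embedding_bounded mu p q;
       exists2 C : R, 0 < C & forall J : interval R,
         bounded_set [set` J] -> (forall y : R, (- y \in J) = (y \in J)) ->
         (mu (Qbox J) <= (C * length J `^ (q / p'))%:E)%E;
       exists2 C : R, 0 < C & forall z : R, 0 < z ->
         (cLnorm mu (Cplus R) q (laplace (expfun z%:C))
            <= C%:E * norm_halfline p (expfun z%:C))%E;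
       exists2 C : R, 0 < C & forall n : int,
         (cLnorm mu (Cplus R) q (laplace (expfun ((2 : R) ^ n)%:C))
            <= C%:E * norm_halfline p (expfun ((2 : R) ^ n)%:C))%E].
Proof.
have p0 : 0 < p by exact: lt_trans p_gt1.
have embedding_test : laplace_embedding_bounded mu p q ->
    exists2 C : R, 0 < C & forall z : R, 0 < z ->
      (cLnorm mu (Cplus R) q (laplace (expfun z%:C))
         <= C%:E * norm_halfline p (expfun z%:C))%E.
  by move=> [C C0 hC]; exists C => // z z0; apply: hC; exact: Lp_expfun.
have test_dyadic : (exists2 C : R, 0 < C & forall z : R, 0 < z ->
      (cLnorm mu (Cplus R) q (laplace (expfun z%:C))
         <= C%:E * norm_halfline p (expfun z%:C))%E) ->
    exists2 C : R, 0 < C & forall n : int,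
      (cLnorm mu (Cplus R) q (laplace (expfun ((2 : R) ^ n)%:C))
         <= C%:E * norm_halfline p (expfun ((2 : R) ^ n)%:C))%E.
  by move=> [C C0 hC]; exists C => // n; apply: hC; rewrite exprz_gt0.
have dyadic_box : (exists2 C : R, 0 < C & forall n : int,
      (cLnorm mu (Cplus R) q (laplace (expfun ((2 : R) ^ n)%:C))
         <= C%:E * norm_halfline p (expfun ((2 : R) ^ n)%:C))%E) ->
    exists2 C : R, 0 < C & forall J : interval R,
      bounded_set [set` J] -> (forall y : R, (- y \in J) = (y \in J)) ->
      (mu (Qbox J) <= (C * length J `^ (q / p'))%:E)%E.
  move=> [C C0 hC]; exists ((15 / 2 * C) `^ q).
    by rewrite powR_gt0// mulr_gt0.
  exact: (box_of_dyadic_test p_gt1 le_pq pp' C0 hC).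
have box_embedding : (exists2 C : R, 0 < C & forall J : interval R,
      bounded_set [set` J] -> (forall y : R, (- y \in J) = (y \in J)) ->
      (mu (Qbox J) <= (C * length J `^ (q / p'))%:E)%E) ->
    laplace_embedding_well_defined mu p q /\ laplace_embedding_bounded mu p q.
  move=> [C C0 hC].
  exact: (laplace_embedding_of_box theta_gt0 theta_lt mu_supp p_gt1 le_pq pp'
    C0 hC).
tfae.
- by move=> [_ /embedding_test/test_dyadic/dyadic_box].
- by move=> /box_embedding[_ /embedding_test].
- exact: test_dyadic.
- by move=> /dyadic_box/box_embedding.
Qed.
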